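(* Let $n$ be a positive integer, let $\gamma \ge 5$, let $z\in\mathbb{C}$ with $|z| \leq 1/4$, and let $n \ge 2 \gamma \log \gamma$. Let $\mathbb{J}$ be the $n\times n$ matrix with all entries on the super-diagonal equal to $1$ and all other entries equal to zero, and let $R$ be an arbitrary deterministic $n\times n$ matrix where each entry is $\pm n^{-\gamma}$. Then the smallest singular value of $\mathbb{J}+R-zI$ is at least $0.15\, n^{-\gamma}$.
   Context: $I$ is the $n\times n$ identity matrix; $\log$ is the natural logarithm. *)

(* Defs.v *)
From HB Require Import structures.
From mathcomp Require Import all_boot all_order all_algebra.
From mathcomp Require Import complex.
From mathcomp Require Import boolp classical_sets reals exp.

Set Implicit Arguments.
Unset Strict Implicit.
Unset Printing Implicit Defensive.

Import Order.TTheory GRing.Theory Num.Theory.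

Local Open Scope classical_set_scope.
Local Open Scope ring_scope.
Local Open Scope complex_scope.
Local Open Scope sesquilinear_scope.

(* [eigenvalue] acts on row vectors, which does not change the spectrum; every
   eigenvalue of A^t* *m A is real and nonnegative. *)
Definition singular_values (K : realType) (n : nat) (A : 'M[K[i]]_n) : set K :=
  [set s | 0 <= s /\ eigenvalue (A^t* *m A) (s ^+ 2)%:C].

(* For 0 < n this infimum is attained, see smallest_singular_valueP. *)
Definition smallest_singular_value (K : realType) (n : nat)
  (A : 'M[K[i]]_n) : K := inf (singular_values A).

Definition shift_mx (K : realType) (n : nat) : 'M[K[i]]_n :=
  \matrix_(i, j) (j == i.+1 :> nat)%:R.

Lemma eigenvalue_gram_ge0 (C : numClosedFieldType) (n : nat) (A : 'M[C]_n)
  (a : C) : eigenvalue (A^t* *m A) a -> 0 <= a.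
Proof.
case/eigenvalueP => v Av v0.
have dot_ge0 m (w : 'rV[C]_m) : 0 <= (w *m w^t*) 0 0.
  by rewrite mxE sumr_ge0// => i _; rewrite !mxE mul_conjC_ge0.
have dot_eq0 m (w : 'rV[C]_m) : (w *m w^t*) 0 0 = 0 -> w = 0.
  rewrite mxE => /eqP; rewrite psumr_eq0; last first.
    by move=> i _; rewrite !mxE mul_conjC_ge0.
  move=> /allP w0; apply/rowP => i; rewrite mxE.
  have := w0 i (mem_index_enum i).
  by rewrite !mxE mul_conjC_eq0 => /eqP.
have vv : 0 < (v *m v^t*) 0 0.
  rewrite lt0r dot_ge0 andbT; apply/eqP => /dot_eq0 /eqP.
  by rewrite (negbTE v0).
rewrite -(pmulr_lge0 _ vv).
suff -> : a * (v *m v^t*) 0 0 = ((v *m A^t*) *m (v *m A^t*)^t*) 0 0 by [].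
have -> : (v *m A^t*)^t* = A *m v^t*.
  rewrite trmx_mul map_mxM; congr (_ *m _).
  by apply/matrixP => i j; rewrite !mxE; apply: conjCK.
by rewrite mulmxA -[v *m _ *m A]mulmxA Av -scalemxAl [RHS]mxE.
Qed.

Lemma smallest_singular_valueP (K : realType) (n : nat) (A : 'M[K[i]]_n) :
  (0 < n)%N ->
  singular_values A (smallest_singular_value A) /\
  forall s, singular_values A s -> smallest_singular_value A <= s.
Proof.
move=> n0.
set G := A^t* *m A.
have [rs Grs] := closed_field_poly_normal (char_poly G).
have eigG a : eigenvalue G a = (a \in rs).
  rewrite eigenvalue_root_char Grs.
  by rewrite (monicP (char_poly_monic G)) scale1r root_prod_XsubC.
have [r0 r0G] := eigenvalue_closed G n0.
pose f (a : K[i]) := Num.sqrt (complex.Re a).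
have fE a : a \in rs -> 0 <= f a /\ ((f a) ^+ 2)%:C = a.
  rewrite -eigG => /eigenvalue_gram_ge0; rewrite lecE /= => /andP[/eqP ai ar].
  split; first exact: sqrtr_ge0.
  by rewrite sqr_sqrtr//; case: a ai ar => x y /= ->.
have svE s : singular_values A s <-> s \in map f rs.
  split=> [[s0 sG]|/mapP[a ars ->]].
    apply/mapP; exists (s ^+ 2)%:C; first by rewrite -eigG.
    by rewrite /f /= sqrtr_sqr ger0_norm.
  have [fa0 fa] := fE a ars.
  have aG : eigenvalue G ((f a) ^+ 2)%:C by rewrite fa eigG.
  by apply: conj; [exact: fa0 | exact: aG].
have [m mrs mle] : exists2 m, m \in map f rs & forall s, s \in map f rs -> m <= s.
  have : map f rs != [::].
    by move: r0G; rewrite eigG; case: (rs).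
  elim: (map f rs) => // x [|y l] IH _.
    by exists x; rewrite ?mem_head// => s; rewrite inE => /eqP ->.
  have [//|m ml mle] := IH.
  have [xm|mx] := leP x m.
    exists x; first exact: mem_head.
    by move=> s; rewrite inE => /predU1P[->//|/mle]; apply: le_trans.
  exists m; first by rewrite inE ml orbT.
  by move=> s; rewrite inE => /predU1P[->|/mle//]; apply: ltW.
have mlb : lbound (singular_values A) m by move=> s /svE /mle.
have mA : singular_values A m by apply/svE.
have -> : smallest_singular_value A = m.
  apply/eqP; rewrite eq_le; apply/andP; split.
    by apply: ge_inf => //; exists m.
  by apply: lb_le_inf => //; exists m.
by split=> // s /mlb.
Qed.

(* Main.v *)
(* Let d := n^-gamma, A := J + R - z, let x be a unit vector with
   |(A x)_k| <= 0.15 d for all k, and put S := R x.  Off the last row,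
   x_(i+1) = z x_i + (A x)_i - S_i, a recursion contracting by |z| <= 1/4, so
   x_i = z^i x_0 + f_i with |f_i| <= 4/3 max |(A x)_i - S_i|.  The crude bound
   |S_i| <= n d makes f negligible, hence |x_0| >= 0.96, and then
   |S_i| <= (4/3 |x_0| + small) d while |S_(n-1)| >= (2/3 |x_0| - small) d.
   Reusing the recursion with this refined bound on S, the last row
   (A x)_(n-1) = - z^n x_0 - z f_(n-1) + S_(n-1) yields
   0.15 d >= (2/9 |x_0| - 0.05 - small) d - 4^-n, which is absurd.  The term
   4^-n is negligible because n^gamma <= e^n as soon as n >= 2 gamma ln gamma. *)
Require Import Defs.
From mathcomp Require Import all_boot all_order all_algebra.
From mathcomp Require Import complex.
From mathcomp Require Import boolp classical_sets reals sequences exp.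
From mathcomp Require Import ring lra.

Import Order.TTheory GRing.Theory Num.Theory.
Import Normc.

Local Open Scope ring_scope.
Local Open Scope complex_scope.

(** * Numerical estimates for logarithms, exponentials and powers *)

(* From expR (-1/8) >= 7/8. *)
Lemma expR1_le (K : realType) : expR 1 <= (8 / 7) ^+ 8 :> K.
Proof.
have -> : expR 1 = expR (8^-1) ^+ 8 :> K.
  by rewrite -expRM_natl; congr expR; field.
rewrite lerXn2r ?nnegrE ?expR_ge0//; first by lra.
have := expR_ge1Dx (- 8^-1 : K); rewrite expRN.
have := expR_gt0 (8^-1 : K); set e := expR _ => e0 h.
have : (1 - 8^-1) * e <= e^-1 * e by rewrite ler_pM2r.
by rewrite mulVf ?gt_eqF//; lra.
Qed.

(** [expR 3] is at most [(8 / 7) ^+ 24], which is just below [5 ^+ 2]. *)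
Lemma ln5_ge (K : realType) : 3 / 2 <= ln 5 :> K.
Proof.
have h3 : expR 3 <= 5 ^+ 2 :> K.
  rewrite -[X in expR X]mulr1 expRM_natl.
  apply: (@le_trans _ _ (((8 / 7) ^+ 8) ^+ 3)).
    by rewrite lerXn2r ?nnegrE ?expR_ge0 ?expR1_le// exprn_ge0//; lra.
  lra.
have : ln (expR 3) <= ln (5 ^+ 2) :> K.
  by rewrite ler_ln ?posrE ?expR_gt0 ?exprn_gt0.
by rewrite expRK lnXn//; lra.
Qed.

Lemma powR_le_expR (K : realType) (x y : K) : 1 <= y -> 0 < x ->
  2 * y * ln y <= x -> x `^ y <= expR x.
Proof.
(* ln lies below its tangent line at 2 y: ln x <= ln (2 y) + x / (2 y) - 1. *)
move=> y1 x0 hx.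
have y0 : 0 < y by lra.
have yn : y != 0 by rewrite gt_eqF.
have h2y : 0 < 2 * y by lra.
have l2 : ln 2 <= 1 :> K.
  by have := @le_ln1Dx K 1; rewrite (_ : 1 + 1 = 2)//; apply; lra.
have hl : ln x <= ln 2 + ln y + x / (2 * y) - 1.
  rewrite -lnM ?posrE// -(lnK (_ : x / (2 * y) \is Num.pos)); last first.
    by rewrite posrE divr_gt0.
  have := expR_ge1Dx (ln (x / (2 * y))).
  by rewrite ln_div ?posrE//; lra.
rewrite /powR gt_eqF// ler_expR.
have : y * ln x <= y * (ln 2 + ln y + x / (2 * y) - 1) by rewrite ler_pM2l.
have -> : y * (ln 2 + ln y + x / (2 * y) - 1) =
  y * ln 2 + (2 * y * ln y) / 2 + x / 2 - y by field.
(* The term [- y] absorbs [y * ln 2], and the hypothesis bounds [y * ln y] by [x / 2]. *)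
have : y * ln 2 <= y * 1 by rewrite ler_pM2l.
lra.
Qed.

(** The value 15 is [2 * 5 * (3 / 2)], as [ln g >= ln 5 >= 3 / 2]. *)
Lemma dimension_ge15 (K : realType) (n : nat) (g : K) : 5 <= g ->
  2 * g * ln g <= n%:R -> (15 <= n)%N.
Proof.
move=> g5 hn; rewrite -(ler_nat K); apply: le_trans hn.
have : ln 5 <= ln g by rewrite ler_ln ?posrE//; lra.
by have := ln5_ge K; nra.
Qed.

(** The product is at most [n^-3], and [3375 = 15 ^+ 3]. *)
Lemma sqr_mul_powRN_le (K : realType) (n : nat) (g : K) : 5 <= g ->
  (15 <= n)%N -> n%:R ^+ 2 * n%:R `^ (- g) <= 1 / 3375.
Proof.
move=> g5 n15.
have N15 : (15 : K) <= n%:R by rewrite ler_nat.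
have n0 : 0 < n%:R :> K by lra.
apply: (@le_trans _ _ (n%:R ^+ 2 * n%:R `^ (- 5))).
  by rewrite ler_pM2l ?exprn_gt0// ler_powR; lra.
rewrite powR_invn ?ler0n//.
have -> : n%:R ^+ 2 * n%:R ^- 5 = (n%:R ^+ 3)^-1 :> K by field; lra.
rewrite div1r lef_pV2 ?posrE ?exprn_gt0//.
have -> : 3375 = 15 ^+ 3 :> K by lra.
by rewrite lerXn2r ?nnegrE ?ler0n.
Qed.

(** As [n^g <= e^n], it suffices to bound [(e / 4)^n]. The base is below 0.73, so its 15th power is
    already below [1 / 100]. *)
Lemma quarter_expr_le (K : realType) (n : nat) (g : K) : 1 <= g ->
  (15 <= n)%N -> 2 * g * ln g <= n%:R ->
  (1 / 4) ^+ n <= 1 / 100 * n%:R `^ (- g).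
Proof.
move=> g1 n15 hn.
have n0 : 0 < n%:R :> K by rewrite ltr0n (leq_trans _ n15).
have := powR_le_expR K n%:R g g1 n0 hn.
rewrite -[X in expR X]mulr1 expRM_natl => h.
rewrite powRN ler_pdivlMr ?powR_gt0//.
apply: (@le_trans _ _ ((1 / 4) ^+ n * expR 1 ^+ n)).
  by rewrite ler_pM2l// exprn_gt0//; lra.
rewrite -exprMn.
apply: (@le_trans _ _ ((1 / 4 * (8 / 7) ^+ 8) ^+ n)).
  by have := expR1_le K; have := expR_ge0 (1 : K) => e0 e8;
    rewrite lerXn2r ?nnegrE; lra.
apply: (@le_trans _ _ ((1 / 4 * (8 / 7) ^+ 8) ^+ 15)); last by lra.
by apply: ler_wiXn2l => //; lra.
Qed.

(** * Complex modulus and geometric sums *)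

Lemma normc_ge0 (K : rcfType) (x : K[i]) : 0 <= normc x.
Proof. by case: x => a b; exact: sqrtr_ge0. Qed.

Lemma normrE_normc (K : rcfType) (x : K[i]) : `|x| = (normc x)%:C.
Proof. by case: x. Qed.

Lemma le_normc_sum (K : rcfType) (n : nat) (F : 'I_n -> K[i]) :
  normc (\sum_i F i) <= \sum_i normc (F i).
Proof.
elim/big_rec2: _ => [|i a b _ ab]; first by rewrite normc0.
by apply: le_trans (le_normcD _ _) _; rewrite lerD2l.
Qed.

Lemma le_normcB (K : rcfType) (x y : K[i]) :
  normc (x - y) <= normc x + normc y.
Proof. by rewrite -(normcN y); exact: le_normcD. Qed.

Lemma normcX (K : rcfType) (x : K[i]) (k : nat) : normc (x ^+ k) = normc x ^+ k.
Proof.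
by elim: k => [|k IH]; rewrite ?expr0 ?normc1 // !exprS normcM IH.
Qed.

Lemma geometric_sum_le (K : realFieldType) (a : K) (n : nat) :
  0 <= a -> (1 - a) * \sum_(j < n) a ^+ j <= 1.
Proof.
move=> a0; rewrite -opprB mulNr -subrX1 opprB lerBlDr lerDl.
exact: exprn_ge0.
Qed.

(** * The contracting recursion and its row sums *)

Section Perturbation.
Variables (K : rcfType) (m : nat) (z : K[i]).
Hypothesis z14 : normc z <= 1 / 4.

Lemma normc_expr_le k : normc (z ^+ k) <= (1 / 4) ^+ k.
Proof. by rewrite normcX lerXn2r ?nnegrE ?normc_ge0//; lra. Qed.

(** The constant is the fixed point of the error recursion [e -> E + e / 4]. *)
Lemma approx_geometric (X : nat -> K[i]) (E : K) : 0 <= E ->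
  (forall i, (i < m)%N -> normc (X i.+1 - z * X i) <= E) ->
  forall i, (i <= m)%N -> normc (X i - z ^+ i * X 0%N) <= 4 / 3 * E.
Proof.
move=> E0 step; elim=> [|i IH] im.
  rewrite expr0 mul1r subrr normc0; lra.
have -> : X i.+1 - z ^+ i.+1 * X 0%N =
    (X i.+1 - z * X i) + z * (X i - z ^+ i * X 0%N) by rewrite exprS; ring.
apply: le_trans (le_normcD _ _) _; rewrite normcM.
have h1 := step _ im; have h2 := IH (ltnW im).
have h3 : normc z * normc (X i - z ^+ i * X 0%N) <= 1 / 4 * (4 / 3 * E).
  by apply: ler_pM; rewrite ?normc_ge0.
by lra.
Qed.

Variables (d : K) (R : nat -> nat -> K[i]) (X : nat -> K[i]).
Let n := m.+1.
Let S k := \sum_(j < n) R k j * X j.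
Let a : K := normc (X 0%N).
Hypothesis d_gt0 : 0 < d.
Hypothesis normR : forall k j, (k < n)%N -> (j < n)%N -> normc (R k j) = d.

Section Approx.
Variable F : K.
Hypothesis F_ge0 : 0 <= F.
Hypothesis XF : forall i, (i < n)%N -> normc (X i - z ^+ i * X 0%N) <= F.

Lemma normc_le_geometric i : (i < n)%N -> normc (X i) <= (1 / 4) ^+ i * a + F.
Proof.
move=> im; rewrite -[X i](subrK (z ^+ i * X 0%N)) addrC.
apply: le_trans (le_normcD _ _) _; rewrite lerD ?XF// normcM.
by rewrite ler_wpM2r ?normc_ge0 ?normc_expr_le.
Qed.

Lemma row_sum_le k : (k < n)%N -> normc (S k) <= d * (4 / 3 * a + n%:R * F).
Proof.
move=> kn; apply: le_trans (le_normc_sum _ _ _) _.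
apply: (@le_trans _ _ (\sum_(j < n) d * ((1 / 4) ^+ j * a + F))).
  apply: ler_sum => j _; rewrite normcM normR//.
  by rewrite ler_pM2l// normc_le_geometric.
rewrite -mulr_sumr ler_pM2l// big_split/= sumr_const card_ord.
rewrite -[F *+ _]mulr_natl.
rewrite lerD2r -mulr_suml ler_wpM2r ?normc_ge0//.
have := geometric_sum_le K (1 / 4) n; lra.
Qed.

(** The term [j = 0] has modulus exactly [d * a], while the geometric tail [1/4 + 1/16 + ...] is at
    most [1 / 3]: whatever the phases in [R], the tail cannot cancel the head. *)
Lemma row_sum_ge k : (k < n)%N -> d * (2 / 3 * a - n%:R * F) <= normc (S k).
Proof.
move=> kn; rewrite /S big_ord_recl /=.
set T := \sum_(i < m) _.
have TB : normc T <= d * (1 / 3 * a + n%:R * F).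
  apply: le_trans (le_normc_sum _ _ _) _.
  apply: (@le_trans _ _ (\sum_(j < m) d * ((1 / 4) ^+ j.+1 * a + F))).
    apply: ler_sum => j _; have jn : (j.+1 < n)%N by rewrite ltnS.
    rewrite normcM (normR k j.+1)// ler_pM2l//.
    exact: (normc_le_geometric j.+1).
  rewrite -mulr_sumr ler_pM2l// big_split/= sumr_const card_ord.
  rewrite -[F *+ _]mulr_natl.
  apply: lerD; last by rewrite ler_wpM2r// ler_nat.
  rewrite -mulr_suml ler_wpM2r ?normc_ge0//.
  under eq_bigr do rewrite exprS.
  rewrite -mulr_sumr.
  have := geometric_sum_le K (1 / 4) m; lra.
have : normc (R k 0%N * X 0%N) <= normc (R k 0%N * X 0%N + T) + normc T.
  by rewrite -{1}[R k 0%N * X 0%N](addrK T) le_normcB.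
by rewrite normcM normR// -/a; lra.
Qed.

(** With [q = 4^-i], both [x <= 1] and [q * a <= 1] turn [x <= q * a + F] into
    [x ^+ 2 <= (q * a) ^+ 2 + 2 * F]. For a unit vector this forces [a] close to 1. *)
Lemma sqr_sum_le : (forall i, (i < n)%N -> normc (X i) <= 1) ->
  \sum_(i < n) normc (X i) ^+ 2 <= 16 / 15 * a ^+ 2 + 2 * (n%:R * F).
Proof.
move=> X1.
have a1 : a <= 1 by exact: X1.
have a0 : 0 <= a by exact: normc_ge0.
apply: (@le_trans _ _ (\sum_(i < n) ((1 / 16) ^+ i * a ^+ 2 + 2 * F))).
  apply: ler_sum => i _; have i1 := X1 i (ltn_ord i).
  have iF := normc_le_geometric i (ltn_ord i).
  have i0 := normc_ge0 _ (X i).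
  have -> : (1 / 16 : K) ^+ i = (1 / 4) ^+ i * (1 / 4) ^+ i.
    by rewrite -exprMn; congr (_ ^+ _); field.
  have q0 : 0 <= (1 / 4 : K) ^+ i by apply: exprn_ge0; lra.
  have q1 : (1 / 4 : K) ^+ i <= 1 by apply: exprn_ile1; lra.
  move: i1 iF i0 q0 q1; set q := _ ^+ _; set x := normc _ => i1 iF i0 q0 q1.
  have qa0 : 0 <= q * a by rewrite mulr_ge0.
  have qa1 : q * a <= 1 by rewrite mulr_ile1.
  have h1 : x * x <= (q * a + F) * x by rewrite ler_wpM2r.
  have h2 : (q * a) * x <= (q * a) * (q * a + F) by rewrite ler_wpM2l.
  have h3 : F * x <= F by rewrite ler_piMr.
  have h4 : q * a * F <= F by rewrite ler_piMl.
  by rewrite !expr2; lra.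
rewrite big_split/= sumr_const card_ord -mulr_suml.
rewrite -[2 * F *+ m.+1]mulr_natl (mulrCA _ 2) lerD2r.
rewrite ler_wpM2r ?sqr_ge0//.
have := geometric_sum_le K (1 / 16) n; lra.
Qed.

End Approx.

End Perturbation.

(* The convention X n = 0 lets the last row obey the same formula as the others. *)
Lemma exists_large_entry (K : rcfType) (m : nat) (z : K[i]) (d : K)
    (R : nat -> nat -> K[i]) (X : nat -> K[i]) (n := m.+1)
    (S := fun k => \sum_(j < n) R k j * X j) :
  normc z <= 1 / 4 -> 0 < d ->
  (forall k j, (k < n)%N -> (j < n)%N -> normc (R k j) = d) ->
  (15 <= n)%N -> n%:R ^+ 2 * d <= 1 / 3375 -> (1 / 4) ^+ n <= 1 / 100 * d ->
  X n = 0 -> \sum_(i < n) normc (X i) ^+ 2 = 1 ->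
  exists2 k, (k < n)%N & 15 / 100 * d < normc (X k.+1 - z * X k + S k).
Proof.
move=> z14 d_gt0 normR n15 nd zn Xn X2.
have [//|noex] := pselect (exists2 k, (k < n)%N &
  15 / 100 * d < normc (X k.+1 - z * X k + S k)); exfalso.
have wB k : (k < n)%N -> normc (X k.+1 - z * X k + S k) <= 15 / 100 * d.
  by move=> kn; rewrite leNgt; apply/negP => kw; apply: noex; exists k.
have X1 i : (i < n)%N -> normc (X i) <= 1.
  move=> im; rewrite -(@ler_pXn2r _ 2) ?nnegrE ?normc_ge0 ?ler01//.
  rewrite expr1n -X2 (bigD1 (Ordinal im))//= lerDl sumr_ge0// => j _.
  exact: sqr_ge0.
pose a : K := normc (X 0%N).
have a0 : 0 <= a by exact: normc_ge0.
(* Any bound on the row sums yields one on the deviation from [z ^+ i * X 0]; it is applied to the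
   crude bound first, then to the refined one. *)
have step (B : K) : (forall k, (k < n)%N -> normc (S k) <= B) ->
    forall i, (i < n)%N ->
    normc (X i - z ^+ i * X 0%N) <= 4 / 3 * (15 / 100 * d + B).
  move=> SB; apply: (approx_geometric _ _ _ z14).
    have B0 : 0 <= B := le_trans (normc_ge0 _ _) (SB 0%N erefl); lra.
  move=> i im; rewrite -[_ - _](addrK (S i)).
  apply: le_trans (le_normcB _ _ _) _.
  by rewrite lerD ?wB ?SB ?(ltnW im)//; exact: (leqW im).
have N15 : (15 : K) <= n%:R by rewrite ler_nat.
pose F : K := 4 / 3 * (15 / 100 * d + n%:R * d).
have F0 : 0 <= F.
  by rewrite /F mulr_ge0 ?addr_ge0 ?mulr_ge0 ?(ltW d_gt0)//; lra.
have XF : forall i, (i < n)%N -> normc (X i - z ^+ i * X 0%N) <= F.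
  apply: step => k kn; apply: le_trans (le_normc_sum _ _ _) _.
  rewrite mulr_natl -[n in leRHS]card_ord -sumr_const.
  apply: ler_sum => j _; rewrite normcM normR//.
  by rewrite ler_piMr ?(ltW d_gt0) ?X1.
(* Numerically [4 / 3 * (0.15 / 15 + 1) / 3375 < 0.0004]. *)
have eta : n%:R * F <= 4 / 10000.
  have h : n%:R * d <= n%:R ^+ 2 * d / 15.
    have := mulr_ge0 (mulr_ge0 (ltW d_gt0) (ler0n K n)) (_ : 0 <= n%:R - 15).
    by rewrite subr_ge0 => /(_ N15); lra.
  have -> : n%:R * F = 4 / 3 * (15 / 100 * (n%:R * d) + n%:R ^+ 2 * d).
    by rewrite /F; ring.
  lra.
have nF0 : 0 <= n%:R * F by rewrite mulr_ge0.
set eta' := n%:R * F in eta nF0.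
(* Otherwise the squares sum to at most [16 / 15 * 0.96^2 + 0.0008 < 1]. *)
have a96 : 96 / 100 <= a.
  have := sqr_sum_le _ _ _ z14 _ F F0 XF X1; rewrite X2.
  rewrite -/n -/a -/eta' => h; rewrite leNgt; apply/negP => ha.
  have : a ^+ 2 <= (96 / 100) ^+ 2.
    by rewrite lerXn2r ?nnegrE ?(ltW ha)//; lra.
  lra.
have XE := step _ (row_sum_le _ _ _ z14 _ _ _ d_gt0 normR F XF).
have := row_sum_ge _ _ _ z14 _ _ _ d_gt0 normR F F0 XF m (ltnSn m).
rewrite -/n -/a -/eta'.
(* The last row is solved for its row sum; [X n = 0] removes the shift term. *)
have Sm : S m = (X n - z * X m + S m) + z * (X m - z ^+ m * X 0%N)
    + z ^+ n * X 0%N.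
  by rewrite Xn exprS; ring.
have : normc (S m) <= 15 / 100 * d
    + 1 / 4 * (4 / 3 * (15 / 100 * d + d * (4 / 3 * a + eta'))) + 1 / 100 * d.
  rewrite Sm; apply: le_trans (le_normcD _ _) _; apply: lerD; last first.
    rewrite normcM -[leRHS]mulr1; apply: ler_pM; rewrite ?normc_ge0 ?X1//.
    by apply: le_trans (normc_expr_le _ _ z14 _) zn.
  apply: le_trans (le_normcD _ _) _; apply: lerD; first exact: wB.
  by rewrite normcM; apply: ler_pM; rewrite ?normc_ge0// XE.
rewrite -/n -/a -/eta' => hu hl.
(* After division by [d] this reads [2 / 9 * a <= 0.21 + 4 / 3 * eta'], whereas [a >= 0.96] makes
   the left side exceed 0.213. *)
have : d * (2 / 3 * a - eta') <=
    d * (15 / 100 + 1 / 3 * (15 / 100 + 4 / 3 * a + eta') + 1 / 100) by lra.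
by rewrite ler_pM2l//; lra.
Qed.

(** * Unit vectors realizing a singular value *)

Section SingularVector.
Local Open Scope sesquilinear_scope.

Lemma sqr_normr_normc (K : rcfType) (x : K[i]) :
  x * Num.conj x = (normc x ^+ 2)%:C.
Proof. by rewrite -normCK normrE_normc rmorphXn. Qed.

Lemma trmxCK (C : numClosedFieldType) (p q : nat) (B : 'M[C]_(p, q)) :
  B^t*^t* = B.
Proof. by apply/matrixP => i j; rewrite !mxE; exact: conjCK. Qed.

Lemma gram_mxE (K : rcfType) (p : nat) (y : 'cV[K[i]]_p) :
  (y^t* *m y) 0 0 = (\sum_i normc (y i 0) ^+ 2)%:C.
Proof.
rewrite mxE rmorph_sum; apply: eq_bigr => i _.
by rewrite !mxE mulrC; exact: sqr_normr_normc.
Qed.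

(** The Gram matrix is Hermitian, so the adjoint [y] of a row eigenvector is a column eigenvector,
    and [y^* A^* A y = s^2 y^* y]. Rescaling by [1 / sqrt N] normalizes [y]. *)
Lemma singular_vector (K : realType) (n : nat) (A : 'M[K[i]]_n) (s : K) :
  singular_values A s ->
  exists x : 'cV[K[i]]_n, \sum_i normc (x i 0) ^+ 2 = 1 /\
    \sum_i normc ((A *m x) i 0) ^+ 2 = s ^+ 2.
Proof.
move=> [s0 /eigenvalueP[v vA v0]].
pose y : 'cV_n := v^t*.
have Ay : A^t* *m (A *m y) = (s ^+ 2)%:C *: y.
  have := congr1 (fun B : 'rV_n => B^t*) vA.
  rewrite trmx_mul map_mxM trmx_mul map_mxM trmxCK.
  rewrite linearZ map_mxZ /= -mulmxA => ->; congr (_ *: _).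
  by apply/conj_Creal/ger0_real; rewrite ler0c sqr_ge0.
pose N := \sum_i normc (y i 0) ^+ 2.
have N0 : 0 < N.
  rewrite lt_def sumr_ge0 ?andbT; last by move=> i _; exact: sqr_ge0.
  apply: contra v0; rewrite psumr_eq0 => [/allP h|i _]; last exact: sqr_ge0.
  apply/eqP/rowP => i; have := h i (mem_index_enum i).
  rewrite sqrf_eq0 => /eqP/eq0_normc; rewrite !mxE => /eqP.
  by rewrite conjC_eq0 => /eqP.
have AyN : \sum_i normc ((A *m y) i 0) ^+ 2 = s ^+ 2 * N.
  apply: complexI; rewrite -gram_mxE trmx_mul map_mxM -mulmxA Ay.
  rewrite -scalemxAr mxE gram_mxE; exact/esym/rmorphM.
pose c := Num.sqrt N^-1.
have c2 : c ^+ 2 = N^-1 by rewrite sqr_sqrtr// invr_ge0 ltW.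
have scale (u : 'cV[K[i]]_n) :
    \sum_i normc ((c%:C *: u) i 0) ^+ 2 = N^-1 * \sum_i normc (u i 0) ^+ 2.
  rewrite mulr_sumr; apply: eq_bigr => i _.
  rewrite mxE normcM exprMn -c2; congr (_ * _).
  by rewrite /= expr0n addr0 sqr_sqrtr ?sqr_ge0.
exists (c%:C *: y); rewrite -scalemxAr !scale AyN.
by split; [rewrite mulVf ?gt_eqF|rewrite mulrCA mulVf ?gt_eqF ?mulr1].
Qed.

End SingularVector.

Theorem lemma5p3 (K : realType) (n : nat) (gamma : K) (z : K[i])
    (R : 'M[K[i]]_n) :
  (0 < n)%N ->
  5 <= gamma ->
  `|z| <= 1 / 4 ->
  2 * gamma * ln gamma <= n%:R ->
  (forall i j : 'I_n, R i j = (n%:R `^ (- gamma))%:C \/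
                      R i j = - (n%:R `^ (- gamma))%:C) ->
  (15 / 100) * n%:R `^ (- gamma) <=
    smallest_singular_value (shift_mx K n + R - z%:M).
Proof.
case: n R => // m R n_gt0 g5 z14 hn Rpm.
set n := m.+1 in R n_gt0 hn Rpm *.
set d : K := n%:R `^ (- gamma).
have d0 : 0 < d by apply: powR_gt0; rewrite ltr0n.
have n15 := dimension_ge15 K n gamma g5 hn.
have nd := sqr_mul_powRN_le K n gamma g5 n15.
have g1 : 1 <= gamma by lra.
have zn := quarter_expr_le K n gamma g1 n15 hn.
set A := _ - _.
have [svA _] := smallest_singular_valueP A n_gt0.
have [s0 _] := svA.
move: (smallest_singular_value A) svA s0 => s svA s0.
have [x [x1 Ax]] := singular_vector K n A s svA.
have z14' : normc z <= 1 / 4.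
  by rewrite -lecR -normrE_normc rmorphM fmorphV !rmorph_nat.
(* The default 0 beyond the last index supplies [X n = 0]. *)
pose X j : K[i] := if insub j is Some i then x i 0 else 0.
pose R' i j : K[i] := R (inord i) (inord j).
have XE (i : 'I_n) : X i = x i 0 by rewrite /X valK.
have Xn : X n = 0 by rewrite /X insubF// ltnn.
have normR k j : (k < n)%N -> (j < n)%N -> normc (R' k j) = d.
  move=> _ _; have dE : normc d%:C = d.
    by rewrite /= expr0n addr0 sqrtr_sqr ger0_norm ?(ltW d0).
  by rewrite /R'; case: (Rpm (inord k) (inord j)) => ->; rewrite ?normcN.
have X2 : \sum_(i < n) normc (X i) ^+ 2 = 1.
  by rewrite -x1; apply: eq_bigr => i _; rewrite XE.
have [k kn] := exists_large_entry K m z d R' X z14' d0 normR n15 nd zn Xn X2.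
suff -> : X k.+1 - z * X k + \sum_(j < n) R' k j * X j =
    (A *m x) (Ordinal kn) 0.
  (* A single entry of [A *m x] is at most its Euclidean norm, which is [s]. *)
  move=> /ltW dk; apply: le_trans dk _.
  rewrite -(@ler_pXn2r _ 2) ?nnegrE ?normc_ge0// -Ax.
  by rewrite (bigD1 (Ordinal kn))//= lerDl sumr_ge0// => i _; exact: sqr_ge0.
have -> : (A *m x) (Ordinal kn) 0 = (shift_mx K n *m x) (Ordinal kn) 0
    + (R *m x) (Ordinal kn) 0 - z * x (Ordinal kn) 0.
  by rewrite /A mulmxBl mulmxDl mul_scalar_mx !mxE.
rewrite addrAC -XE; congr (_ + _ - _); rewrite mxE.
  transitivity (\sum_(j < n) if j == k.+1 :> nat then X j else 0).
    (* In the last row, [k.+1 = n], the sum is empty and matches the default value of [X]. *)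
    rewrite -big_mkcond /=; case: (ltnP k.+1 n) => kn1.
      by rewrite (big_pred1 (Ordinal kn1)).
    rewrite big_pred0 => [|j]; first by rewrite /X insubF// ltnNge kn1.
    by apply/negbTE; rewrite neq_ltn (leq_trans (ltn_ord j) kn1).
  apply: eq_bigr => j _; rewrite mxE XE /=.
  by case: (_ == _); rewrite ?mul1r ?mul0r.
apply: eq_bigr => j _; rewrite XE /R' inord_val; congr (R _ _ * _).
by apply: val_inj; rewrite /= inordK.
Qed.
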